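(* Let $g$ be a probability density on $(0,\infty)$ with finite mean, $\tilde G(s)=\int_0^\infty e^{-st}g(t)\,dt$, and $f(d\mid s)=g(d)e^{-sd}/\tilde G(s)$ for $s\ge0$. Let $e\ge1$ and let $\mathbf d=(d_1,\dots,d_e)$ be observed edge lengths with $g(d_i)>0$ for all $i$ and sample mean $\bar d=\frac1e\sum_{i=1}^e d_i$. Consider the log-likelihood $\ell(s\mid\mathbf d)=\sum_{i=1}^e\ln f(d_i\mid s)$. Then $$\frac{\partial}{\partial s}\ell(s\mid\mathbf d)=-e\,\frac{\tilde G'(s)}{\tilde G(s)}-\sum_{i=1}^e d_i ,$$ so the likelihood equation $\frac{\partial}{\partial s}\ell(s\mid\mathbf d)=0$ is equivalent to $$\frac{\tilde G'(s)}{\tilde G(s)}=-\bar d ,$$ and consequently the maximum likelihood estimator of $s$ (the solution of the likelihood equation) is also the moment-matching estimator, i.e. the value of $s$ for which the expected edge length $\int_0^\infty t\,f(t\mid s)\,dt$ equals $\bar d$.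
   Context: In the Waxman random graph, $n$ nodes are placed independently and uniformly at random in a region and each pair at distance $d$ is linked independently with probability $q e^{-sd}$, $q\in(0,1]$, $s\ge 0$. Here $g$ is the density of the distance between two independent uniformly random points of the region, and $f(\cdot\mid s)$ is the density of the length of an edge. The likelihood is taken under the assumption that the edge lengths are independent. At $s=0$ derivatives are right derivatives. *)

(* Defs.v *)
From HB Require Import structures.
From mathcomp Require Import all_boot all_order all_algebra.
From mathcomp Require Import all_classical all_reals all_analysis.

Set Implicit Arguments.
Unset Strict Implicit.
Unset Printing Implicit Defensive.

Import Order.TTheory GRing.Theory Num.Theory.
Import numFieldNormedType.Exports.

Local Open Scope classical_set_scope.
Local Open Scope ring_scope.

(* Differentiation with respect to a parameter s >= 0: the ordinary two-sided
   derivative for s > 0 and the right derivative at s = 0. *)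
Definition diff_quot (R : realType) (F : R -> R) (s h : R) : R :=
  h^-1 * (F (s + h) - F s).

Definition derivable_ge0 (R : realType) (F : R -> R) (s : R) : Prop :=
  if s == 0 then cvg (diff_quot F s h @[h --> 0^'+]) else derivable F s 1.

Definition derive_ge0 (R : realType) (F : R -> R) (s : R) : R :=
  if s == 0 then lim (diff_quot F s h @[h --> 0^'+]) else derive1 F s.

(* Densities on ]0, +oo[ are total functions R -> R, of which only the values
   on ]0, +oo[ matter. *)
Definition density_pos (R : realType) (g : R -> R) : Prop :=
  [/\ measurable_fun (`]0, +oo[ : set R) g,
      forall t, 0 < t -> 0 <= g t &
      (\int[@lebesgue_measure R]_(t in `]0%R, +oo[) (g t)%:E = 1)%E].

Definition finite_mean (R : realType) (g : R -> R) : Prop :=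
  (\int[@lebesgue_measure R]_(t in `]0%R, +oo[) (t * g t)%:E < +oo)%E.

Definition laplace (R : realType) (g : R -> R) (s : R) : R :=
  \int[@lebesgue_measure R]_(t in `]0, +oo[) (expR (- (s * t)) * g t).

Definition edge_density (R : realType) (g : R -> R) (s t : R) : R :=
  g t * expR (- (s * t)) / laplace g s.

Definition loglik (R : realType) (g : R -> R) (e : nat) (d : 'I_e -> R)
    (s : R) : R :=
  \sum_(i < e) ln (edge_density g s (d i)).

Definition sample_mean (R : realType) (e : nat) (d : 'I_e -> R) : R :=
  e%:R^-1 * \sum_(i < e) d i.

Definition mean_edge_length (R : realType) (g : R -> R) (s : R) : \bar R :=
  (\int[@lebesgue_measure R]_(t in `]0%R, +oo[) (t * edge_density g s t)%:E)%E.

Definition likelihood_equation (R : realType) (g : R -> R) (e : nat)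
    (d : 'I_e -> R) (s : R) : Prop :=
  derive_ge0 (loglik g d) s = 0.

Definition moment_matching (R : realType) (g : R -> R) (e : nat)
    (d : 'I_e -> R) (s : R) : Prop :=
  mean_edge_length g s = (sample_mean d)%:E.

Definition likelihood_maximizer (R : realType) (g : R -> R) (e : nat)
    (d : 'I_e -> R) (s : R) : Prop :=
  0 <= s /\ forall s', 0 <= s' -> loglik g d s' <= loglik g d s.

(* Main.v *)
Require Import Defs.
From HB Require Import structures.
From mathcomp Require Import all_boot all_order all_algebra.
From mathcomp Require Import all_classical all_reals all_analysis.
From mathcomp Require Import measurable_realfun ring lra.

Import Order.TTheory GRing.Theory Num.Theory.
Import numFieldNormedType.Exports.

Local Open Scope classical_set_scope.
Local Open Scope ring_scope.

(** Write G for the Laplace transform of g, M(s) for the integral of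
t e^{-st} g(t), and mu(s) = M(s) / G(s) for the expected edge length at s.
Everything follows from the elementary strict inequality e^x > 1 + x for
x <> 0. Applied at x = -(s' - s)(t - m) and integrated against e^{-st} g(t),
it gives, for nonnegative s <> s' and every real m
([laplace_tilted_tangent]),

  e^{(s' - s) m} G(s') > (1 + (s' - s) m) G(s) - (s' - s) M(s).

For m = 0 this says that -M is a subgradient of G; for m = mu(s) the right-hand
side is just G(s), and taking logarithms shows that -mu is a strict subgradient
of ln G. Hence the log-likelihood, which up to a constant is
-s (d_1 + ... + d_e) - e ln G(s), lies strictly below its tangent at s, of
slope e mu(s) - (d_1 + ... + d_e), except at s itself ([loglik_tangent]).

A function with a continuous subgradient is differentiable with that
derivative ([has_derive_ge0_subgradient]). As M and mu are continuous by
dominated convergence, this yields both derivatives, including the right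
derivatives at 0, without differentiating under the integral sign. The
likelihood equation then reads mu(s) = sample mean, which is at once the
equation for G'/G and moment matching, and a point where the tangent is
horizontal is the unique global maximizer. Conversely the derivative vanishes
at a positive maximizer, which is interior. *)

(** * Derivatives on the half-line *)

Section HalfLineDerivative.
Context {R : realType}.
Implicit Types (F phi : R -> R) (s : R).

(** The increments along which the derivative on the half-line is taken, so that
[s = 0] and [s > 0] can be treated together. *)
Definition nbhs_ge0 s : set_system R := if s == 0 then 0^'+ else 0^'.

#[global] Instance nbhs_ge0_filter s : ProperFilter (nbhs_ge0 s).
Proof. by rewrite /nbhs_ge0; case: ifP => _; exact: _. Qed.

Lemma nbhs_ge0_sub0 (s : R) : nbhs_ge0 s `=>` nbhs (0 : R).
Proof.
rewrite /nbhs_ge0; case: ifP => _; last exact: nbhs_dnbhs.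
exact: cvg_within.
Qed.

Lemma near_ge0 (s : R) : 0 <= s ->
  \forall h \near nbhs_ge0 s, h != 0 /\ 0 <= s + h.
Proof.
rewrite /nbhs_ge0 le_eqVlt eq_sym; case: ifP => [/eqP -> _|_ /= s0].
  near=> h.
  have h0 : 0 < h by near: h; exact: nbhs_right_gt.
  by rewrite add0r gt_eqF// ltW.
near=> h; split; first by near: h; exact: nbhs_dnbhs_neq.
have : `|h| < s by near: h; exact: dnbhs0_lt.
by rewrite ltr_norml => /andP[]; lra.
Unshelve. all: by end_near. Qed.

Definition has_derive_ge0 F s (l : R) :=
  diff_quot F s h @[h --> nbhs_ge0 s] --> l.

Lemma derivable_derive_ge0 F s l :
  has_derive_ge0 F s l -> derivable_ge0 F s /\ derive_ge0 F s = l.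
Proof.
rewrite /has_derive_ge0 /nbhs_ge0 /derivable_ge0 /derive_ge0.
case: ifP => _ Fl; first by split; [apply/cvg_ex; exists l|exact: cvg_lim].
have E : (fun h : R => h^-1 *: ((F \o shift s) (h *: 1) - F s)) = diff_quot F s.
  by apply/funext => h; rewrite /diff_quot /= /GRing.scale/= mulr1 [s + h]addrC.
split; first by rewrite /derivable E; apply/cvg_ex; exists l.
by rewrite derive1E /derive E; exact: cvg_lim.
Qed.

Lemma has_derive_ge0N F s l :
  has_derive_ge0 (fun x => - F x) s l -> has_derive_ge0 F s (- l).
Proof.
rewrite /has_derive_ge0 => /cvgN; apply: cvg_trans.
rewrite (_ : diff_quot F s = - diff_quot (fun x => - F x) s)//.
by apply/funext => h; rewrite /diff_quot fctE; ring.
Qed.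

(** The subgradient inequality at [s] and at [s + h] puts the increment of [F]
between [h * phi s] and [h * phi (s + h)]; the difference quotient is therefore
no further from [phi s] than [phi (s + h)] is. *)
Lemma has_derive_ge0_subgradient F phi s :
  0 <= s ->
  (forall x y, 0 <= x -> 0 <= y -> (y - x) * phi x <= F y - F x) ->
  phi (s + h) @[h --> nbhs_ge0 s] --> phi s ->
  has_derive_ge0 F s (phi s).
Proof.
move=> s0 sub cphi.
apply/cvgrPdist_le => eps eps0.
move/cvgrPdist_le : cphi => /(_ _ eps0); apply: filterS2 (near_ge0 s s0).
move=> h [h0 sh0]; apply: le_trans.
have ub := sub _ _ s0 sh0; have lb := sub _ _ sh0 s0.
have hn : 0 < `|h| by rewrite normr_gt0.
rewrite -(ler_pM2l hn) -!normrM /diff_quot.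
have -> : h * (phi s - h^-1 * (F (s + h) - F s))
  = h * phi s - (F (s + h) - F s) by field.
rewrite ler0_norm; last by move: ub; lra.
rewrite -normrN; apply: le_trans (ler_norm _).
move: ub lb; lra.
Qed.

Lemma interior_max_derive_ge0 F phi s :
  (forall x, 0 <= x -> has_derive_ge0 F x (phi x)) ->
  0 < s -> (forall x, 0 <= x -> F x <= F s) -> phi s = 0.
Proof.
move=> dF s0 Fmax.
have dF' x : 0 < x -> derivable F x 1 /\ derive1 F x = phi x.
  move=> x0; have := derivable_derive_ge0 _ _ _ (dF x (ltW x0)).
  by rewrite /derivable_ge0 /derive_ge0 gt_eqF.
have [_ <-] := dF' s s0; rewrite derive1E.
have s1 : 0 <= s + 1 :> R by lra.
have [] // := @derive1_at_max _ F 0 (s + 1) s s1.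
- by move=> t; rewrite in_itv/= => /andP[/dF'[]].
- by rewrite in_itv/= s0/=; lra.
- by move=> t; rewrite in_itv/= => /andP[/ltW /Fmax].
Qed.

End HalfLineDerivative.

(** * Laplace integrals of integrable functions *)

Section LaplaceIntegral.
Context {R : realType}.
Notation mu := (@lebesgue_measure R).
Notation D := (`]0%R, +oo[%classic : set R).
Implicit Types (p g w : R -> R) (s t : R).

Lemma integrable_laplace p s : 0 <= s -> mu.-integrable D (EFin \o p) ->
  mu.-integrable D (EFin \o (fun t => expR (- (s * t)) * p t)).
Proof.
move=> s0 ip.
have mp : measurable_fun D p by apply/measurable_EFinP; exact: measurable_int ip.
apply: le_integrable ip => //.
  apply/measurable_EFinP; apply: measurable_funM => //.
  apply: measurableT_comp => //; apply: measurable_funN.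
  exact: measurable_funM.
move=> t /=; rewrite in_itv/= andbT => t0.
rewrite lee_fin normrM ger0_norm ?expR_ge0// ler_piMl//.
by rewrite -expR0 ler_expR oppr_le0 mulr_ge0// ltW.
Qed.

(** Dominated convergence. The kernel is first extended to negative parameters
as e^{-|x| t}, which keeps [`|p|] as a dominating function on a two-sided
neighbourhood of [s], including [s = 0]. *)
Lemma laplace_continuous_ge0 p s : 0 <= s -> mu.-integrable D (EFin \o p) ->
  laplace p (s + h) @[h --> nbhs_ge0 s] --> laplace p s.
Proof.
move=> s0 ip.
pose H (x : R) := \int[mu]_(t in D) (expR (- (`|x| * t)) * p t).
have HE x : 0 <= x -> H x = laplace p x by move=> x0; rewrite /H ger0_norm.
have cH : {for s, continuous H}.
  have sI : s \in (`]s - 1, s + 1[%classic : set R).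
    by rewrite inE/= in_itv/=; lra.
  apply: (@continuity_under_integral _ _ _ mu
    (fun x t => expR (- (`|x| * t)) * p t) D _ (s - 1) (s + 1) _ _
    (fun t => `|p t|) _ _ s sI) => //.
  - by move=> x _; exact: integrable_laplace.
  - apply: aeW => t _ x _.
    apply: cvgMl.
    apply: (@continuous_comp _ _ _ (fun x => - (`|x| * t)) expR); last first.
      exact: continuous_expR.
    apply: cvgN; apply: cvgMl; exact: norm_continuous.
  - exact: integrable_norm.
  - move=> x _; apply: aeW => t /=; rewrite in_itv/= andbT => t0.
    rewrite normrM ger0_norm ?expR_ge0// ler_piMl//.
    by rewrite -expR0 ler_expR oppr_le0 mulr_ge0// ltW.
rewrite -HE//.
have -> : H s = H (s + 0) by rewrite addr0.
have : H (s + h) @[h --> nbhs_ge0 s] --> H (s + 0).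
  apply: cvg_trans (_ : H (s + h) @[h --> (0 : R)] --> H (s + 0)).
    by apply: cvg_app; exact: nbhs_ge0_sub0.
  apply: (@continuous_comp _ _ _ (fun h => s + h) H).
    by apply: cvgD; [exact: cvg_cst|exact: cvg_id].
  by rewrite addr0.
apply: cvg_trans; apply: near_eq_cvg.
by apply: filterS (near_ge0 s s0) => h [_ /HE].
Qed.

(** The probability with density [g] has no atoms, so a nonnegative weight
vanishing at no more than one point cannot vanish almost everywhere for it. *)
Lemma Rintegral_weight_gt0 g w m : density_pos g ->
  mu.-integrable D (EFin \o (fun t => w t * g t)) ->
  (forall t, 0 < t -> 0 <= w t) ->
  (forall t, 0 < t -> t != m -> w t != 0) ->
  0 < \int[mu]_(t in D) (w t * g t).
Proof.
move=> [mg g0 g1] iwg w0 wn0.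
have D0 t : D t -> 0 < t by rewrite /= in_itv/= andbT.
rewrite lt_neqAle; apply/andP; split; last first.
  by apply: Rintegral_ge0 => t /D0 t0; rewrite mulr_ge0// ?w0 ?g0.
apply/eqP => int0.
have aewg : ae_eq mu D (EFin \o (fun t => w t * g t)) (cst 0%E).
  apply/ae_eq_integral_abs => //; first exact: measurable_int iwg.
  under eq_integral => t /set_mem /D0 t0.
    rewrite gee0_abs; last by rewrite lee_fin mulr_ge0 ?w0 ?g0.
    over.
  rewrite -[LHS]fineK; last exact: integrable_fin_num iwg.
  congr EFin; exact: esym int0.
have aem : {ae mu, forall t : R, t != m}.
  exists [set m]; split => //; first exact: lebesgue_measure_set1.
  by move=> t /= /negP; rewrite negbK => /eqP.
have : (\int[mu]_(t in D) (g t)%:E = \int[mu]_(t in D) (cst 0 t))%E.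
  apply: ae_eq_integral => //; first exact/measurable_EFinP.
  apply: filterS2 aewg aem => t wg0 tm Dt.
  have /= [/eqP] := wg0 Dt.
  by rewrite mulf_eq0 (negbTE (wn0 _ (D0 _ Dt) tm))/= => /eqP ->.
by rewrite g1 integral0 => -[/eqP]; rewrite oner_eq0.
Qed.

End LaplaceIntegral.

(** * Expected edge length and score *)

Definition length_weighted {R : realType} (g : R -> R) (t : R) : R := t * g t.

Definition mean_length {R : realType} (g : R -> R) (s : R) : R :=
  laplace (length_weighted g) s / laplace g s.

(** This is the slope of the log-likelihood at [s], by [has_derive_loglik]. *)
Definition score {R : realType} (g : R -> R) {e : nat} (d : 'I_e -> R)
    (s : R) : R :=
  e%:R * mean_length g s - \sum_(i < e) d i.

Section EdgeLengthModel.
Context {R : realType} {g : R -> R}.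
Hypotheses (g_density : density_pos g) (g_mean : finite_mean g).
Notation mu := (@lebesgue_measure R).
Notation D := (`]0%R, +oo[%classic : set R).

Notation tg := (length_weighted g).

Lemma integrable_density : mu.-integrable D (EFin \o g).
Proof.
have [mg g0 g1] := g_density.
apply/integrableP; split; first exact/measurable_EFinP.
under eq_integral => t.
  rewrite inE/= in_itv/= andbT => t0; rewrite ger0_norm ?g0//; over.
by rewrite g1 ltry.
Qed.

Lemma integrable_first_moment : mu.-integrable D (EFin \o tg).
Proof.
have [mg g0 g1] := g_density.
apply/integrableP; split; first by apply/measurable_EFinP; exact: measurable_funM.
under eq_integral => t.
  rewrite inE/= in_itv/= andbT => t0.
  rewrite ger0_norm ?mulr_ge0 ?g0//; last exact: ltW.
  over.
exact: g_mean.
Qed.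

Lemma laplace_gt0 (s : R) : 0 <= s -> 0 < laplace g s.
Proof.
move=> s0; apply: (@Rintegral_weight_gt0 _ g (fun t => expR (- (s * t))) 0) => //.
- exact: integrable_laplace integrable_density.
- by move=> t _ _; rewrite gt_eqF// expR_gt0.
Qed.

(** The difference is the integral of [w * g], where
w(t) = e^{-st} (e^x - (1 + x)) with x = -(s' - s)(t - m), a weight that is
positive except at [t = m]. *)
Lemma laplace_tilted_tangent (m s s' : R) : 0 <= s -> 0 <= s' -> s != s' ->
  0 < expR ((s' - s) * m) * laplace g s' + (s' - s) * laplace tg s
      - (1 + (s' - s) * m) * laplace g s.
Proof.
move=> s0 s'0 ss'.
have ig := integrable_laplace g s s0 integrable_density.
have ig' := integrable_laplace g s' s'0 integrable_density.
have itg := integrable_laplace tg s s0 integrable_first_moment.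
set a := expR _; set b := s' - s; set c := 1 + _.
pose w (t : R) := a * expR (- (s' * t)) + (b * t - c) * expR (- (s * t)).
have wgE t : w t * g t = a * (expR (- (s' * t)) * g t)
    + b * (expR (- (s * t)) * tg t) - c * (expR (- (s * t)) * g t).
  by rewrite /w /length_weighted; ring.
have i1 : mu.-integrable D (EFin \o (fun t => a * (expR (- (s' * t)) * g t))).
  exact: integrableZl ig'.
have i2 : mu.-integrable D (EFin \o (fun t => b * (expR (- (s * t)) * tg t))).
  exact: integrableZl itg.
have i3 : mu.-integrable D (EFin \o (fun t => c * (expR (- (s * t)) * g t))).
  exact: integrableZl ig.
have i12 : mu.-integrable D (EFin \o (fun t => a * (expR (- (s' * t)) * g t)
    + b * (expR (- (s * t)) * tg t))) by exact: (integrableD _ i1 i2).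
have iwg : mu.-integrable D (EFin \o (fun t => w t * g t)).
  rewrite (_ : (fun t => w t * g t) = fun t => a * (expR (- (s' * t)) * g t)
    + b * (expR (- (s * t)) * tg t) - c * (expR (- (s * t)) * g t)).
    exact: (integrableB _ i12 i3).
  exact/funext.
have -> : a * laplace g s' + b * laplace tg s - c * laplace g s
    = \int[mu]_(t in D) (w t * g t).
  under eq_Rintegral do rewrite wgE.
  by rewrite RintegralB// RintegralD// !RintegralZl.
(* the factored form of the weight exhibits the remainder e^x - (1 + x) *)
have wE t : w t = expR (- (s * t)) * (expR (- (b * (t - m))) - (1 - b * (t - m))).
  rewrite /w /a mulrBr -expRD -expRD.
  have -> : - (s * t) + - (b * (t - m)) = (s' - s) * m + - (s' * t).
    by rewrite /b; ring.
  by rewrite /c /b; ring.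
apply: (@Rintegral_weight_gt0 _ g w m) => // t _.
  by rewrite wE mulr_ge0 ?expR_ge0// subr_ge0; exact: expR_ge1Dx.
move=> tm; rewrite wE mulf_neq0 ?gt_eqF ?expR_gt0// subr_gt0 expR_gt1Dx//.
by rewrite oppr_eq0 mulf_neq0// subr_eq0// eq_sym.
Qed.

(** The case [m = 0] of the tilted inequality makes the derivative a
subgradient. *)
Lemma has_derive_laplace (s : R) : 0 <= s ->
  has_derive_ge0 (laplace g) s (- laplace tg s).
Proof.
move=> s0; apply: (has_derive_ge0_subgradient _ (fun x => - laplace tg x)) => //.
  move=> x y x0 y0; have [->|xy] := eqVneq x y; first by rewrite !subrr mul0r.
  have := laplace_tilted_tangent 0 x y x0 y0 xy.
  by rewrite mulr0 expR0; lra.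
by apply: cvgN; exact: laplace_continuous_ge0 integrable_first_moment.
Qed.

Lemma mean_edge_lengthE (s : R) : 0 <= s ->
  mean_edge_length g s = (mean_length g s)%:E.
Proof.
move=> s0; have itg := integrable_laplace tg s s0 integrable_first_moment.
set c := (laplace g s)^-1.
have ictg : mu.-integrable D (EFin \o (fun t => c * (expR (- (s * t)) * tg t))).
  exact: integrableZl itg.
rewrite /mean_length mulrC -RintegralZl// -/c /Rintegral fineK.
  apply: eq_integral => t _; congr EFin.
  by rewrite /edge_density -/c /length_weighted; ring.
exact: integrable_fin_num ictg.
Qed.

Lemma mean_length_continuous_ge0 (s : R) : 0 <= s ->
  mean_length g (s + h) @[h --> nbhs_ge0 s] --> mean_length g s.
Proof.
move=> s0; apply: cvgM.
  exact: laplace_continuous_ge0 integrable_first_moment.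
apply: cvgV; first by rewrite gt_eqF// laplace_gt0.
exact: laplace_continuous_ge0 integrable_density.
Qed.

(** Tilting by [m = mean_length g s] cancels the first-order term, which leaves
[laplace g s < expR ((s' - s) * m) * laplace g s']: strict Jensen for the
exponential of the edge length. *)
Lemma ln_laplace_tangent (s s' : R) : 0 <= s -> 0 <= s' -> s != s' ->
  - ((s' - s) * mean_length g s) < ln (laplace g s') - ln (laplace g s).
Proof.
move=> s0 s'0 ss'; have G0 := laplace_gt0 s s0; have G'0 := laplace_gt0 s' s'0.
have := laplace_tilted_tangent (mean_length g s) s s' s0 s'0 ss'.
set m := mean_length g s.
have -> : laplace tg s = m * laplace g s by rewrite /m /mean_length divfK// gt_eqF.
set E := expR _ => ineq.
have {}ineq : laplace g s < E * laplace g s' by move: ineq; lra.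
have := ineq; rewrite -ltr_ln ?posrE ?mulr_gt0 ?expR_gt0//.
by rewrite lnM ?posrE ?expR_gt0// /E expRK; lra.
Qed.

(** * The log-likelihood *)

Section LogLikelihood.
Context {e : nat} {d : 'I_e -> R}.
Hypotheses (e_ge1 : (1 <= e)%N) (gd_gt0 : forall i, 0 < g (d i)).

Lemma loglikE (s : R) : 0 <= s -> loglik g d s =
  \sum_(i < e) ln (g (d i)) - s * (\sum_(i < e) d i) - e%:R * ln (laplace g s).
Proof.
move=> s0; have G0 := laplace_gt0 s s0.
transitivity (\sum_(i < e) (ln (g (d i)) - s * d i - ln (laplace g s))).
  apply: eq_bigr => i _; rewrite /edge_density.
  by rewrite ln_div ?posrE ?mulr_gt0 ?expR_gt0// lnM ?posrE ?expR_gt0// expRK.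
by rewrite !sumrB sumr_const card_ord mulr_natl mulr_sumr.
Qed.

(** Strict concavity in tangent form; it gives both the derivative and the
uniqueness of the maximizer. *)
Lemma loglik_tangent (s s' : R) : 0 <= s -> 0 <= s' -> s != s' ->
  loglik g d s' < loglik g d s + (s' - s) * score g d s.
Proof.
move=> s0 s'0 ss'; rewrite !loglikE// /score.
have e0 : 0 < e%:R :> R by rewrite ltr0n.
have := ln_laplace_tangent s s' s0 s'0 ss'; rewrite -(ltr_pM2l e0).
by lra.
Qed.

Lemma has_derive_loglik (s : R) : 0 <= s ->
  has_derive_ge0 (loglik g d) s (score g d s).
Proof.
move=> s0; rewrite -[score g d s]opprK; apply: has_derive_ge0N.
apply: (has_derive_ge0_subgradient _ (fun x => - score g d x)) => //.
  move=> x y x0 y0; have [->|xy] := eqVneq x y; first by rewrite !subrr mul0r.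
  by have := loglik_tangent x y x0 y0 xy; lra.
apply: cvgN; apply: cvgB; last exact: cvg_cst.
by apply: cvgMr; exact: mean_length_continuous_ge0.
Qed.

Lemma score_eq0 (s : R) : score g d s = 0 <-> mean_length g s = sample_mean d.
Proof.
have e0 : e%:R != 0 :> R by rewrite pnatr_eq0 -lt0n.
rewrite /score /sample_mean; split => [/eqP|->]; last by rewrite mulVKf// subrr.
by rewrite subr_eq0 => /eqP <-; rewrite mulKf.
Qed.

Lemma score0_unique_maximizer (s : R) : 0 <= s -> score g d s = 0 ->
  likelihood_maximizer g d s /\
  (forall s', likelihood_maximizer g d s' -> s' = s).
Proof.
move=> s0 sc0.
have lt s' : 0 <= s' -> s != s' -> loglik g d s' < loglik g d s.
  by move=> s'0 ss'; have := loglik_tangent s s' s0 s'0 ss'; rewrite sc0 mulr0 addr0.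
split.
  by split => // s' s'0; have [<-//|/(lt _ s'0)/ltW] := eqVneq s s'.
move=> s' [s'0 /(_ s s0) le]; apply/eqP; rewrite eq_sym; apply/negPn/negP.
by move=> /(lt _ s'0); rewrite ltNge le.
Qed.

End LogLikelihood.
End EdgeLengthModel.

Theorem mainTheorem5 (R : realType) (g : R -> R)
    (g_density : density_pos g) (g_mean : finite_mean g)
    (e : nat) (e_ge1 : (1 <= e)%N) (d : 'I_e -> R)
    (d_gt0 : forall i, 0 < d i) (gd_gt0 : forall i, 0 < g (d i)) :
  [/\ (forall s : R, 0 <= s ->
        [/\ derivable_ge0 (laplace g) s,
            derivable_ge0 (loglik g d) s &
            derive_ge0 (loglik g d) s =
              - (e%:R * (derive_ge0 (laplace g) s / laplace g s))
              - \sum_(i < e) d i]),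
      (forall s : R, 0 <= s ->
        (likelihood_equation g d s <->
         derive_ge0 (laplace g) s / laplace g s = - sample_mean d)),
      (forall s : R, 0 <= s ->
        (likelihood_equation g d s <-> moment_matching g d s)) &
      (forall s : R, 0 <= s -> likelihood_equation g d s ->
         likelihood_maximizer g d s /\
         (forall s', likelihood_maximizer g d s' -> s' = s)) /\
      (forall s : R, 0 < s -> likelihood_maximizer g d s ->
         likelihood_equation g d s)].
Proof.
have dG s (s0 : 0 <= s) :=
  derivable_derive_ge0 _ _ _ (has_derive_laplace g_density g_mean s s0).
have dl s (s0 : 0 <= s) := derivable_derive_ge0 _ _ _
  (has_derive_loglik g_density g_mean e_ge1 gd_gt0 s s0).
have ratioE s : 0 <= s ->
    derive_ge0 (laplace g) s / laplace g s = - mean_length g s.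
  by move=> /dG[_ ->]; rewrite mulNr.
have eqE s : 0 <= s ->
    likelihood_equation g d s <-> mean_length g s = sample_mean d.
  move=> s0; rewrite /likelihood_equation; have [_ ->] := dl s s0.
  exact: score_eq0.
split.
- move=> s s0; have [? ?] := dG s s0; have [? lE] := dl s s0; split => //.
  by rewrite lE ratioE// mulrN opprK.
- move=> s s0; rewrite ratioE// eqE//.
  by split=> [->//|/oppr_inj].
- move=> s s0; rewrite eqE// /moment_matching mean_edge_lengthE//.
  by split=> [->//|[]].
- split=> s s0.
    by move=> /eqE-/(_ s0) /(score_eq0 e_ge1); exact: score0_unique_maximizer.
  move=> [_ smax]; rewrite /likelihood_equation; have [_ ->] := dl s (ltW s0).
  apply: (interior_max_derive_ge0 (loglik g d) (score g d) s) => // x x0.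
  exact: has_derive_loglik.
Qed.
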